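(* Let $\{x^{ag}_k\}$ be the iterates generated by the UAG algorithm (described in the context) with parameters $\{\alpha_k\},\{\beta_k\},\{\lambda_k\}$, applied to the problem $\Psi^*=\min_{x\in X}\{\Psi(x)=f(x)+\mathcal{X}(x)\}$, where $f$ has $L$-Lipschitz continuous gradient on $X$. Let $\Gamma_1:=1$ and $\Gamma_k:=(1-\alpha_k)\Gamma_{k-1}$ for $k\ge 2$. (a) Suppose that $\Psi$ is bounded below over $X$, i.e., $\Psi^*$ is finite. If $\{\beta_k\}$ is chosen such that $\beta_k\le \frac{2}{L}$ for all $k$, then for any $N\ge 1$ such that $\beta_k<2/L$ for at least one $k\in\{1,\dots,N\}$, we have $$\min_{k=1,\ldots,N}\|g_{X,k}\|^2\le \frac{\Psi(x_0)-\Psi^*}{\sum_{k=1}^N\beta_k\left(1-\frac{L\beta_k}{2}\right)}.$$ (b) Suppose that $f$ is convex and an optimal solution $x^*$ exists for the problem $\min_{x\in X}\Psi(x)$. If $\{\alpha_k\}$ and $\{\lambda_k\}$ (with $\{\beta_k\}$ any positive sequence) are chosen such that $\alpha_k\lambda_k\le\frac1L$ for all $k\ge 1$ and $$\frac{\alpha_1}{\lambda_1\Gamma_1}\ge\frac{\alpha_2}{\lambda_2\Gamma_2}\ge\ldots,$$ then for any $N\ge 1$, we have $$\Psi(x^{ag}_N)-\Psi(x^* )\le\frac{\Gamma_N\|x_0-x^*\|^2}{2\lambda_1}.$$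
   Context: Setting: $X\subseteq\mathbb{R}^n$ is a closed convex set, $f:X\to\mathbb{R}$ is differentiable and possibly nonconvex, $\mathcal{X}$ is a (possibly nondifferentiable) convex real-valued function on $X$, $\Psi:=f+\mathcal{X}$, and $\Psi^*:=\min_{x\in X}\Psi(x)$ denotes the optimal value (infimum). $\|\cdot\|$ is the Euclidean norm and $f'$ is the gradient of $f$. There is $L>0$ with $\|f'(y)-f'(x)\|\le L\|y-x\|$ for all $x,y\in X$. UAG algorithm. Input: $x_0\in X$; $\{\alpha_k\}_{k\ge1}$ with $\alpha_1=1$ and $\alpha_k\in(0,1)$ for $k\ge2$; sequences $\lambda_k>0$, $\beta_k>0$. Set $x^{ag}_0=x_0$. For $k=1,2,\ldots$: 1. $x^{md}_k=(1-\alpha_k)x^{ag}_{k-1}+\alpha_k x_{k-1}$. 2. Set $x_k=\arg\min_{u\in X}\{\langle f'(x^{md}_k),u\rangle+\frac{1}{2\lambda_k}\|u-x_{k-1}\|^2+\mathcal{X}(u)\}$, $\tilde x^{ag}_k=(1-\alpha_k)x^{ag}_{k-1}+\alpha_k x_k$, $\bar x^{ag}_k=\arg\min_{u\in X}\{\langle f'(x^{ag}_{k-1}),u\rangle+\frac{1}{2\beta_k}\|u-x^{ag}_{k-1}\|^2+\mathcal{X}(u)\}$ (the minimizers in these subproblems are assumed to exist). 3. Choose $x^{ag}_k\in\{\bar x^{ag}_k,\tilde x^{ag}_k\}$ such that $\Psi(x^{ag}_k)=\min\{\Psi(\bar x^{ag}_k),\Psi(\tilde x^{ag}_k)\}$.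 The generalized projected gradient is $g_{X,k}:=(x^{ag}_{k-1}-\bar x^{ag}_k)/\beta_k$. *)

(* Defs.v *)
From HB Require Import structures.
From mathcomp Require Import all_boot all_order all_algebra.
From mathcomp Require Import all_classical all_reals all_analysis.

Set Implicit Arguments.
Unset Strict Implicit.
Unset Printing Implicit Defensive.

Import Order.TTheory GRing.Theory Num.Theory.
Import numFieldNormedType.Exports.

Local Open Scope classical_set_scope.
Local Open Scope ring_scope.

Section Euclidean.
Context {R : realType} {n : nat}.
Implicit Types (u v x y : 'rV[R]_n) (X : set 'rV[R]_n).

Definition dotv u v : R := \sum_(i < n) u ord0 i * v ord0 i.

(* The library norm on ['rV_n] is the sup norm; it induces the same topology. *)
Definition enorm u : R := Num.sqrt (dotv u u).

(* [f] is differentiable on [X] with gradient map [f']. Differentiability at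
   [x] is relative to [X], so only the values of [f] on [X] matter and [X] may
   have boundary points or an empty interior; a function differentiable on a
   neighbourhood of [X] in the usual sense is a special case. *)
Definition is_gradient_on X (f : 'rV[R]_n -> R) (f' : 'rV[R]_n -> 'rV[R]_n) :=
  forall x, X x -> forall e : R, 0 < e ->
    \forall y \near within X (nbhs x),
      `|f y - f x - dotv (f' x) (y - x)| <= e * enorm (y - x).

(* Lipschitz for the Euclidean norm, unlike the library [lipschitz_on]. *)
Definition elipschitz_on X (L : R) (F : 'rV[R]_n -> 'rV[R]_n) :=
  forall x y, X x -> X y -> enorm (F y - F x) <= L * enorm (y - x).

Definition is_argmin X (phi : 'rV[R]_n -> R) u :=
  X u /\ forall v, X v -> phi u <= phi v.

End Euclidean.

Section UAG.
Context {R : realType} {n : nat}.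

(* Objective of the subproblem with gradient [g], prox-centre [c] and
   stepsize [t]. *)
Definition prox_model (chi : 'rV[R]_n -> R) (g c : 'rV[R]_n) (t : R)
    (u : 'rV[R]_n) : R :=
  dotv g u + (2 * t)^-1 * enorm (u - c) ^+ 2 + chi u.

(* The value at index 0 of each parameter sequence is unused. *)
Record uag_parameters (alpha beta lambda : nat -> R) : Prop := {
  uag_alpha1 : alpha 1%N = 1;
  uag_alpha_itv : forall k, (2 <= k)%N -> 0 < alpha k < 1;
  uag_beta_gt0 : forall k, (1 <= k)%N -> 0 < beta k;
  uag_lambda_gt0 : forall k, (1 <= k)%N -> 0 < lambda k }.

(* [x 0] is the input point; [xmd], [xtilde] and [xbar] are indexed from 1 and
   their value at 0 is unconstrained. Any tie-breaking in the choice of [xag]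
   is allowed, and existence of the subproblem minimizers is part of the
   predicate. *)
Record uag_iterates (X : set 'rV[R]_n) (f' : 'rV[R]_n -> 'rV[R]_n)
    (chi Psi : 'rV[R]_n -> R) (alpha beta lambda : nat -> R)
    (x xmd xtilde xbar xag : nat -> 'rV[R]_n) : Prop := {
  uag_x0 : X (x 0%N);
  uag_xag0 : xag 0%N = x 0%N;
  uag_xmd : forall k, (1 <= k)%N ->
    xmd k = (1 - alpha k) *: xag k.-1 + alpha k *: x k.-1;
  uag_x : forall k, (1 <= k)%N ->
    is_argmin X (prox_model chi (f' (xmd k)) (x k.-1) (lambda k)) (x k);
  uag_xtilde : forall k, (1 <= k)%N ->
    xtilde k = (1 - alpha k) *: xag k.-1 + alpha k *: x k;
  uag_xbar : forall k, (1 <= k)%N ->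
    is_argmin X (prox_model chi (f' (xag k.-1)) (xag k.-1) (beta k)) (xbar k);
  uag_xag_choice : forall k, (1 <= k)%N -> xag k = xbar k \/ xag k = xtilde k;
  uag_xag_min : forall k, (1 <= k)%N ->
    Psi (xag k) = Num.min (Psi (xbar k)) (Psi (xtilde k)) }.

Definition proj_gradient (beta : nat -> R) (xag xbar : nat -> 'rV[R]_n)
    (k : nat) : 'rV[R]_n :=
  (beta k)^-1 *: (xag k.-1 - xbar k).

(* The clause at 0 is junk: the sequence starts at index 1. *)
Fixpoint uag_Gamma (alpha : nat -> R) (k : nat) : R :=
  match k with
  | 0 | 1 => 1
  | k'.+1 => (1 - alpha k) * uag_Gamma alpha k'
  end.

End UAG.

(* Main.v *)
Require Import Defs.
From HB Require Import structures.
From mathcomp Require Import all_boot all_order all_algebra.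
From mathcomp Require Import all_classical all_reals all_analysis.
From mathcomp Require Import ring lra.

Set Implicit Arguments.
Unset Strict Implicit.
Unset Printing Implicit Defensive.

Import Order.TTheory GRing.Theory Num.Theory.
Import numFieldNormedType.Exports.

Local Open Scope classical_set_scope.
Local Open Scope ring_scope.

(* Two facts drive both bounds: the descent inequality
   [f y <= f x + <f' x, y - x> + L/2 |y - x|^2] and the strong convexity of the
   prox subproblems, which adds [|v - u|^2 / (2 t)] to the optimality of a
   minimizer [u] with stepsize [t].
   (a) Applied to [xbar], they show that each iteration decreases [Psi] by at
   least [beta (1 - L beta / 2) |g|^2]; these decreases telescope to at most
   [Psi (x 0) - Psi^*].
   (b) Applied to [xtilde], for which [xtilde - xmd] is [alpha] times the step
   [x k - x k.-1], they give
   [delta k <= (1 - alpha k) delta k.-1 + alpha k / (2 lambda k) (D k.-1 - D k)]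
   with [delta k = Psi (xag k) - Psi x^*] and [D k = |x k - x^*|^2]; the
   monotonicity of [alpha / (lambda Gamma)] lets the [D] terms telescope. *)

(** * Euclidean inner product and norm *)

Section InnerProduct.
Context {R : realType} {n : nat}.
Implicit Types (u v w : 'rV[R]_n) (a : R).

Lemma dotvC u v : dotv u v = dotv v u.
Proof. by apply: eq_bigr => i _; rewrite mulrC. Qed.

Lemma dotvDr w u v : dotv w (u + v) = dotv w u + dotv w v.
Proof. by rewrite -big_split; apply: eq_bigr => i _; rewrite mxE mulrDr. Qed.

Lemma dotvZr a u v : dotv u (a *: v) = a * dotv u v.
Proof. by rewrite mulr_sumr; apply: eq_bigr => i _; rewrite mxE mulrCA. Qed.

Lemma dotvNr u v : dotv u (- v) = - dotv u v.
Proof. by rewrite -scaleN1r dotvZr mulN1r. Qed.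

Lemma dotvDl w u v : dotv (u + v) w = dotv u w + dotv v w.
Proof. by rewrite dotvC dotvDr !(dotvC w). Qed.

Lemma dotvZl a u v : dotv (a *: u) v = a * dotv u v.
Proof. by rewrite dotvC dotvZr dotvC. Qed.

Lemma dotvNl u v : dotv (- u) v = - dotv u v.
Proof. by rewrite dotvC dotvNr dotvC. Qed.

Definition dotvE := (dotvDr, dotvDl, dotvNr, dotvNl, dotvZr, dotvZl).

Lemma dotv_ge0 u : 0 <= dotv u u.
Proof. by apply: sumr_ge0 => i _; rewrite -expr2 sqr_ge0. Qed.

Lemma sqr_enorm u : enorm u ^+ 2 = dotv u u.
Proof. by rewrite sqr_sqrtr // dotv_ge0. Qed.

Lemma enorm_ge0 u : 0 <= enorm u.
Proof. exact: sqrtr_ge0. Qed.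

Lemma enormZ a u : enorm (a *: u) = `|a| * enorm u.
Proof.
by rewrite /enorm !dotvE mulrA -expr2 sqrtrM ?sqr_ge0// sqrtr_sqr.
Qed.

Lemma enormN u : enorm (- u) = enorm u.
Proof. by rewrite -scaleN1r enormZ normrN1 mul1r. Qed.

(* Stands in for Cauchy-Schwarz: expand [0 <= |u - a v|^2]. *)
Lemma dotv_le_of_sq u v a : 0 < a -> dotv u u <= a ^+ 2 * dotv v v ->
  dotv u v <= a * dotv v v.
Proof.
move=> a0 h; have := dotv_ge0 (u - a *: v).
rewrite !dotvE (dotvC v u) => h2.
rewrite -(ler_pM2l a0); nra.
Qed.

End InnerProduct.

(** * Convex combinations and strong convexity of the prox model *)

Section Convexity.
Context {R : realType} {n : nat} (X : set 'rV[R]_n).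
Implicit Types (u v : 'rV[R]_n) (s : R).

Lemma convex_set_comb u v s : convex_set X -> X u -> X v -> 0 <= s <= 1 ->
  X ((1 - s) *: u + s *: v).
Proof.
move=> cX Xu Xv /andP[s0 s1].
have := cX v u (Itv01 s0 s1); rewrite !inE => /(_ Xv Xu).
by rewrite addrC.
Qed.

Lemma convex_function_comb (phi : 'rV[R]_n -> R) u v s :
  convex_function X phi -> X u -> X v -> 0 <= s <= 1 ->
  phi ((1 - s) *: u + s *: v) <= (1 - s) * phi u + s * phi v.
Proof.
move=> cphi Xu Xv /andP[s0 s1].
have := cphi (Itv01 s0 s1) v u; rewrite !inE => /(_ Xv Xu) h.
by rewrite addrC [leRHS]addrC.
Qed.

Lemma comb_shift u v s : (1 - s) *: u + s *: v = u + s *: (v - u).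
Proof. by rewrite scalerBl scale1r scalerBr addrAC addrA. Qed.

(* Strong convexity of the prox model: compare the minimizer [u] with
   [(1 - s) u + s v] and let [s] tend to [0]. *)
Lemma prox_three_point (chi : 'rV[R]_n -> R) g c t u v :
  convex_set X -> convex_function X chi -> 0 < t ->
  is_argmin X (prox_model chi g c t) u -> X v ->
  prox_model chi g c t u + (2 * t)^-1 * enorm (v - u) ^+ 2
    <= prox_model chi g c t v.
Proof.
move=> cX cchi t0 [Xu umin] Xv.
set T := (2 * t)^-1.
have T0 : 0 < T by rewrite invr_gt0 mulr_gt0.
set D := enorm (v - u) ^+ 2.
have D0 : 0 <= D by rewrite sqr_ge0.
have key s : 0 < s <= 1 -> prox_model chi g c t u + (1 - s) * (T * D)
    <= prox_model chi g c t v.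
  move=> /andP[s0 s1].
  have s01 : 0 <= s <= 1 by rewrite ltW.
  have := umin _ (convex_set_comb cX Xu Xv s01).
  have := convex_function_comb cchi Xu Xv s01.
  rewrite comb_shift /prox_model -/T.
  set w := v - u.
  (* In terms of [w = v - u] and [e = u - c], the difference of the two squared distances to [c] has
     a factor [s], which is then cancelled. *)
  rewrite (_ : v = u + w); last by rewrite /w addrC subrK.
  rewrite 2![_ + _ - c]addrAC /D !sqr_enorm -/w.
  set e := u - c.
  clearbody e w; rewrite !dotvE (dotvC w e) => h1 h2.
  rewrite -(ler_pM2l s0); nra.
apply/ler_addgt0Pr => e e0.
(* This [s] lies in [(0, 1]] and makes the loss [s * (T * D)] in [key] at most [e]. *)
pose s := e / (T * D + e).
have TD0 : 0 <= T * D by rewrite mulr_ge0// ltW.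
have den0 : 0 < T * D + e by rewrite ltr_wpDl.
have := key s; rewrite /s divr_gt0//= ler_pdivrMr// mul1r lerDr => /(_ TD0).
have : e / (T * D + e) * (T * D) <= e.
  by rewrite mulrAC ler_pdivrMr// ler_pM2l// lerDl ltW.
nra.
Qed.

End Convexity.

(** * First-order estimates for [f] along segments of [X] *)

Section Smoothness.
Context {R : realType} {n : nat} (X : set 'rV[R]_n).
Context (f : 'rV[R]_n -> R) (f' : 'rV[R]_n -> 'rV[R]_n).
Hypotheses (cX : convex_set X) (gf : is_gradient_on X f f').
Implicit Types (x y d : 'rV[R]_n) (s t e : R).

Let comb_line x d s : X x -> X (x + d) -> s \in `[0, 1] -> X (x + s *: d).
Proof.
move=> Xx Xd; rewrite in_itv/= => s01.
have := convex_set_comb cX Xx Xd s01.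
by rewrite comb_shift [x + d]addrC addrK.
Qed.

Lemma gradient_segment x d t e : X x -> X (x + d) -> t \in `[0, 1] ->
  0 < e ->
  \forall s \near within `[0, 1] (nbhs t),
    `|f (x + s *: d) - f (x + t *: d) - (s - t) * dotv (f' (x + t *: d)) d|
       <= e * `|s - t|.
Proof.
move=> Xx Xd t01 e0.
(* Adding 1 keeps the divisor positive when [d = 0]. *)
have d0 : 0 < 1 + enorm d by rewrite ltr_pwDl// enorm_ge0.
have ed0 : 0 < e / (1 + enorm d) by rewrite divr_gt0.
have cl : (x + s *: d) @[s --> t] --> x + t *: d.
  by apply: cvgD; [exact: cvg_cst|apply: cvgZr_tmp; exact: cvg_id].
have := cl _ (gf (comb_line Xx Xd t01) ed0).
rewrite /= !near_simpl /within/=.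
apply: filterS => s h s01.
have := h (comb_line Xx Xd s01).
rewrite opprD addrACA subrr add0r -scalerBl dotvZr enormZ => h2.
apply: (le_trans h2).
rewrite mulrCA [leRHS]mulrC ler_wpM2l// -mulrA ler_piMr ?(ltW e0)//.
by rewrite mulrC ler_pdivrMr// mul1r lerDr.
Qed.

(** Supplies the continuity up to the endpoints required by the mean value theorem. The expansion
    with error factor 1 bounds the increment by [(1 + |a|) * |s - t|]. *)
Lemma gradient_segment_cvg x d t : X x -> X (x + d) -> t \in `[0, 1] ->
  f (x + s *: d) @[s --> within `[0, 1] (nbhs t)] --> f (x + t *: d).
Proof.
move=> Xx Xd t01; apply/cvgrPdist_le => e e0.
set a := dotv (f' (x + t *: d)) d.
have a0 : 0 < 1 + `|a| by rewrite ltr_pwDl.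
have near1 : \forall s \near within `[0, 1] (nbhs t),
    (1 + `|a|) * `|s - t| <= e.
  apply: cvg_within; near=> s.
  rewrite -ler_pdivlMl// distrC; near: s.
  by apply: (@cvgr_dist_le _ _ _ (nbhs t) _ id t) => //;
    rewrite mulr_gt0// invr_gt0.
have := gradient_segment Xx Xd t01 ltr01.
apply: filterS2 near1 => s h1; rewrite -/a mul1r => h2.
rewrite distrC; apply: le_trans h1.
have := ler_normD (f (x + s *: d) - f (x + t *: d) - (s - t) * a) ((s - t) * a).
rewrite subrK normrM => h; apply: (le_trans h).
by rewrite [leRHS]mulrDl mul1r lerD// mulrC.
Unshelve. all: by end_near. Qed.

(** At an interior [t] the relative neighbourhoods in [[0, 1]] are ordinary ones, so the relative
    expansion yields a genuine derivative. *)
Lemma gradient_segment_is_derive x d t : X x -> X (x + d) -> t \in `]0, 1[ ->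
  is_derive t 1 (fun s => f (x + s *: d)) (dotv (f' (x + t *: d)) d).
Proof.
move=> Xx Xd t01.
have t01' : t \in `[0, 1] by apply: subset_itv_oo_cc.
set a := dotv _ d.
have cv : h^-1 *: (((fun s => f (x + s *: d)) \o shift t) (h *: 1)
    - f (x + t *: d)) @[h --> 0^'] --> a.
  apply/cvgrPdist_le => e e0.
  have h1 : \forall s \near nbhs t, s \in `]0, 1[ by exact: near_in_itvoo.
  have h2 := gradient_segment Xx Xd t01' e0.
  have h3 : \forall s \near nbhs t,
    `|f (x + s *: d) - f (x + t *: d) - (s - t) * a| <= e * `|s - t|.
    by apply: filterS2 h1 h2 => s /subset_itv_oo_cc s01; apply.
  have cl : (h + t) @[h --> 0^'] --> 0 + t.
    by apply: cvgD; [exact: cvg_within|exact: cvg_cst].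
  rewrite add0r in cl.
  have := cl _ h3; rewrite /= near_simpl/= => h4.
  near=> h.
  have hn0 : h != 0 by near: h; exact: nbhs_dnbhs_neq.
  have : `|f (x + (h + t) *: d) - f (x + t *: d) - (h + t - t) * a|
      <= e * `|h + t - t| by near: h; exact: h4.
  rewrite addrK /= -[h *: 1]/(h * 1) mulr1 => h5.
  rewrite distrC -[X in _ - X](mulKf hn0) -[_ *: _]/(_ * _) -mulrBr normrM.
  by rewrite normfV ler_pdivrMl ?normr_gt0// [leRHS]mulrC.
apply: DeriveDef; first by apply/cvg_ex; exists a.
exact: cvg_lim cv.
Unshelve. all: by end_near. Qed.

(* Mean value theorem along the segment for [f] minus its quadratic upper
   model, whose derivative is nonpositive there by the Lipschitz bound. *)
Lemma descent (L : R) x y : 0 < L -> elipschitz_on X L f' -> X x -> X y ->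
  f y <= f x + dotv (f' x) (y - x) + L / 2 * enorm (y - x) ^+ 2.
Proof.
move=> L0 lip Xx Xy; set d := y - x.
have yE : y = x + d by rewrite /d addrC subrK.
have Xd : X (x + d) by rewrite -yE.
set D := enorm d ^+ 2.
pose q t := t * dotv (f' x) d + L / 2 * D * t ^+ 2.
have dq t : is_derive t 1 q (dotv (f' x) d + L * D * t).
  apply: is_derive_eq.
  rewrite scaler0 add0r /GRing.scale/=.
  change (dotv (f' x) d * 1 + L / 2 * D * (t * 1 + t * 1)
    = dotv (f' x) d + L * D * t :> R).
  by field.
have [||t] := @MVT R (fun s => f (x + s *: d) - q s)
  (fun t => dotv (f' (x + t *: d)) d - (dotv (f' x) d + L * D * t)) 0 1 ltr01.
- move=> t t01; apply: is_deriveB; first exact: gradient_segment_is_derive.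
- apply: within_continuousB.
    by apply/subspace_continuousP => t; exact: gradient_segment_cvg.
  by apply: derivable_within_continuous => t _; apply: ex_derive.
move=> t01; have /andP[t0 t1] : 0 < t < 1 by rewrite in_itv in t01.
rewrite subr0 mulr1 scale1r scale0r addr0 /q -yE => mvt.
have := lip x (x + t *: d) Xx.
rewrite addrAC subrr add0r enormZ gtr0_norm//.
have t01' : t \in `[0, 1] by apply: subset_itv_oo_cc.
move=> /(_ (comb_line Xx Xd t01')) lipt.
set g := f' (x + t *: d) - f' x in lipt.
(* Since [|g| <= L t |d|], the derivative given by the mean value theorem is nonpositive. *)
have gd : dotv g d <= (L * t) * dotv d d.
  apply: dotv_le_of_sq; first by rewrite mulr_gt0.
  rewrite -!sqr_enorm -exprMn ler_sqr ?nnegrE ?enorm_ge0//.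
    by rewrite -mulrA.
  by rewrite !mulr_ge0 ?enorm_ge0// ltW.
rewrite /g dotvDl dotvNl -sqr_enorm -/D in gd.
lra.
Qed.

(** Near [x], the first-order expansion bounds [f (x + s d)] from below up to [e * s], while
    convexity bounds it from above; dividing by [s] leaves an arbitrary error [e]. *)
Lemma convex_gradient_le x y : convex_function X f -> X x -> X y ->
  f x + dotv (f' x) (y - x) <= f y.
Proof.
move=> cf Xx Xy; set d := y - x.
have yE : y = x + d by rewrite /d addrC subrK.
have Xd : X (x + d) by rewrite -yE.
apply/ler_addgt0Pr => e e0.
have z01 : (0 : R) \in `[0, 1] by rewrite in_itv/= lexx ler01.
have := gradient_segment Xx Xd z01 e0.
rewrite scale0r addr0 => /nbhs_ballP[r /= r0] H.
(* Small enough to stay both in the segment and in the ball where the expansion holds. *)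
pose s := Num.min 1 (r / 2).
have s0 : 0 < s by rewrite lt_min ltr01 divr_gt0.
have s1 : s <= 1 by rewrite ge_min lexx.
have sr : s < r by rewrite gt_min [r / 2 < r]ltr_pdivrMr// ltr_pMr// ltr1n orbT.
have := H s; rewrite /ball/= sub0r normrN gtr0_norm// => /(_ sr).
rewrite /= in_itv/= (ltW s0) s1 subr0 (gtr0_norm s0) => /(_ isT).
have s01 : 0 <= s <= 1 by rewrite (ltW s0).
have := convex_function_comb cf Xx Xy s01.
rewrite comb_shift -/d ler_norml => h1 /andP[h2 _].
rewrite -(ler_pM2l s0); nra.
Qed.

End Smoothness.

(** * One-iteration estimates for the two kinds of step *)

Section Steps.
Context {R : realType} {n : nat} (X : set 'rV[R]_n).
Context (f chi : 'rV[R]_n -> R) (f' : 'rV[R]_n -> 'rV[R]_n) (L : R).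
Hypotheses (cX : convex_set X) (gf : is_gradient_on X f f').
Hypotheses (cchi : convex_function X chi).
Hypotheses (L0 : 0 < L) (lip : elipschitz_on X L f').
Let Psi u := f u + chi u.

(** With the prox-centre [y] as comparison point, the prox term and the strong convexity term each
    contribute [|y - w|^2 / (2 b)]; descent costs only [L / 2 * |y - w|^2]. *)
Lemma prox_gradient_decrease b y w : 0 < b -> X y ->
  is_argmin X (prox_model chi (f' y) y b) w ->
  b * (1 - L * b / 2) * enorm (b^-1 *: (y - w)) ^+ 2 <= Psi y - Psi w.
Proof.
move=> b0 Xy am; have [Xw _] := am.
have := prox_three_point cX cchi b0 am Xy.
have := descent cX gf L0 lip Xy Xw.
rewrite /prox_model /Psi !sqr_enorm -opprB subrr.
rewrite (_ : dotv (f' y) y = dotv (f' y) (y - w) + dotv (f' y) w); last first.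
  by rewrite -dotvDr subrK.
rewrite (_ : dotv 0 0 = 0); last first.
  by rewrite -[0 in LHS](scale0r y) dotvZl mul0r.
move: (y - w) => e; rewrite !dotvE !mulrN !opprK => h1 h2.
rewrite (_ : b * _ * _ = b^-1 * dotv e e - L / 2 * dotv e e); last first.
  by field; rewrite gt_eqF.
have b2 : (2 * b)^-1 * dotv e e = b^-1 * dotv e e / 2.
  by field; rewrite gt_eqF.
rewrite b2 in h2; lra.
Qed.

Lemma accelerated_step a l y z w u md t : convex_function X f ->
  0 < a <= 1 -> 0 < l -> a * l <= L^-1 -> X y -> X z -> X u ->
  md = (1 - a) *: y + a *: z -> t = (1 - a) *: y + a *: w ->
  is_argmin X (prox_model chi (f' md) z l) w ->
  Psi t - Psi u <= (1 - a) * (Psi y - Psi u)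
    + a / (2 * l) * (enorm (z - u) ^+ 2 - enorm (w - u) ^+ 2).
Proof.
move=> cf /andP[a0 a1] l0 al Xy Xz Xu mdE tE am; have [Xw _] := am.
have a01 : 0 <= a <= 1 by rewrite ltW.
have Xmd : X md by rewrite mdE; exact: convex_set_comb.
have Xt : X t by rewrite tE; exact: convex_set_comb.
have h1 := descent cX gf L0 lip Xmd Xt.
have h2 := prox_three_point cX cchi l0 am Xu.
have h3 := convex_function_comb cchi Xy Xw a01.
have h4 := convex_gradient_le cX gf cf Xmd Xy.
have h5 := convex_gradient_le cX gf cf Xmd Xu.
have tmd : t - md = a *: (w - z).
  by rewrite tE mdE opprD addrACA subrr add0r scalerBr.
rewrite tmd enormZ exprMn (ger0_norm (ltW a0)) in h1.
move: h1 h2 h4 h5; rewrite /prox_model /Psi.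
rewrite -(opprB u z) -(opprB w u).
have gmd g : dotv g md = (1 - a) * dotv g y + a * dotv g z.
  by rewrite mdE dotvDr !dotvZr.
rewrite ![dotv _ (_ - md)]dotvDr !dotvNr gmd.
rewrite !enormN dotvZr [dotv _ (w - z)]dotvDr dotvNr => h1 h2 h4 h5.
set g := f' md in h1 h2 h4 h5.
set T := (2 * l)^-1 in h2 *.
set W := enorm (w - z) ^+ 2 in h1 h2.
have W0 : 0 <= W by rewrite sqr_ge0.
have Tl : T * (2 * l) = 1 by rewrite mulVf// gt_eqF// mulr_gt0.
have T0 : 0 < T by rewrite invr_gt0 mulr_gt0.
have al1 : a * l * L <= 1 by rewrite -ler_pdivlMr// div1r.
(* The stepsize condition lets the prox term absorb the quadratic error of the descent
   inequality. *)
have aT : L / 2 * a <= T.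
  have : T * (a * l * L) <= T * 1 by rewrite ler_pM2l.
  rewrite (_ : T * (a * l * L) = T * (2 * l) * (L / 2 * a)); last by field.
  by rewrite Tl mul1r mulr1.
have k1 : L / 2 * (a ^+ 2 * W) <= a * (T * W).
  rewrite (_ : L / 2 * (a ^+ 2 * W) = a * (L / 2 * a * W)); last by ring.
  by rewrite ler_pM2l// ler_wpM2r.
(* The gradient inequality at [md] is weighted by [1 - a] towards [y] and by [a] towards [u], so
   that the linear terms cancel. *)
have k2 := ler_wpM2l (ltW a0) h2.
have a1' : 0 <= 1 - a by rewrite subr_ge0.
have k4 := ler_wpM2l a1' h4.
have k5 := ler_wpM2l (ltW a0) h5.
rewrite -tE in h3.
move: h1 h3 k1 k2 k4 k5; lra.
Qed.

End Steps.

(** * Telescoping over the iterations *)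

Theorem theorem2 (R : realType) (n : nat) (X : set 'rV[R]_n)
    (f chi : 'rV[R]_n -> R) (f' : 'rV[R]_n -> 'rV[R]_n) (L : R)
    (alpha beta lambda : nat -> R)
    (x xmd xtilde xbar xag : nat -> 'rV[R]_n)
    (Psi := fun u : 'rV[R]_n => f u + chi u) :
  closed X -> convex_set X ->
  is_gradient_on X f f' ->
  convex_function X chi ->
  0 < L -> elipschitz_on X L f' ->
  uag_parameters alpha beta lambda ->
  uag_iterates X f' chi Psi alpha beta lambda x xmd xtilde xbar xag ->
  (has_lbound (Psi @` X) ->
   (forall k, (1 <= k)%N -> beta k <= 2 / L) ->
   forall N, (1 <= N)%N ->
   (exists k, (1 <= k <= N)%N /\ beta k < 2 / L) ->
   \big[Num.min/enorm (proj_gradient beta xag xbar 1) ^+ 2]_(1 <= k < N.+1)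
      enorm (proj_gradient beta xag xbar k) ^+ 2
   <= (Psi (x 0%N) - inf (Psi @` X)) /
      \sum_(1 <= k < N.+1) beta k * (1 - L * beta k / 2))
  /\
  (convex_function X f ->
   forall xstar, is_argmin X Psi xstar ->
   (forall k, (1 <= k)%N -> alpha k * lambda k <= L^-1) ->
   (forall k, (1 <= k)%N ->
      alpha k.+1 / (lambda k.+1 * uag_Gamma alpha k.+1)
      <= alpha k / (lambda k * uag_Gamma alpha k)) ->
   forall N, (1 <= N)%N ->
   Psi (xag N) - Psi xstar
   <= uag_Gamma alpha N * enorm (x 0%N - xstar) ^+ 2 / (2 * lambda 1%N)).
Proof.
move=> _ cX gf cchi L0 lip [a1 a_itv b0 l0].
move=> [Xx0 xag0 xmdE x_min xtE xbar_min xag_choice xag_min].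
have aP k : (1 <= k)%N -> 0 < alpha k <= 1.
  case: k => [//|[_|k _]]; first by rewrite a1 ltr01 lexx.
  by have /andP[-> /ltW ->] := a_itv k.+2 isT.
have Xx k : X (x k) by case: k => [//|k]; have [] := x_min k.+1 isT.
have Xxag k : X (xag k).
  elim: k => [|k IH]; first by rewrite xag0.
  case: (xag_choice k.+1 isT) => ->; first by have [] := xbar_min k.+1 isT.
  rewrite xtE//; apply: convex_set_comb => //.
  by have /andP[/ltW -> ->] := aP k.+1 isT.
split.
- move=> lbPsi bL N N1 [j [j1N jL]].
  set G := fun k => enorm (proj_gradient beta xag xbar k) ^+ 2.
  set c := fun k => beta k * (1 - L * beta k / 2).
  have c_ge0 k : (1 <= k)%N -> 0 <= c k.
    move=> k1; rewrite mulr_ge0 ?subr_ge0 ?(ltW (b0 k k1))//.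
    by rewrite ler_pdivrMr// mul1r mulrC -ler_pdivlMr// bL.
  have telescope M :
      \sum_(1 <= k < M.+1) c k * G k <= Psi (x 0%N) - Psi (xag M).
    elim: M => [|M IH]; first by rewrite big_geq// xag0 subrr.
    rewrite big_nat_recr//=.
    have := prox_gradient_decrease cX gf cchi L0 lip (b0 M.+1 isT) (Xxag M)
      (xbar_min M.+1 isT).
    rewrite -/(G M.+1) -/(c M.+1) -/(Psi (xag M)) -/(Psi (xbar M.+1)) => dec.
    have : Psi (xag M.+1) <= Psi (xbar M.+1).
      by rewrite xag_min// ge_min lexx.
    lra.
  have jr : j \in index_iota 1 N.+1 by rewrite mem_index_iota ltnS.
  (* The term [j] is positive and the others are nonnegative. *)
  have S0 : 0 < \sum_(1 <= k < N.+1) c k.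
    rewrite (bigD1_seq j) ?iota_uniq//= ltr_pwDl//.
      move/andP: j1N => [j1 _]; rewrite mulr_gt0 ?b0// subr_gt0.
      by rewrite ltr_pdivrMr// mul1r mulrC -ltr_pdivlMr.
    rewrite big_seq_cond; apply: sumr_ge0 => k.
    by rewrite mem_index_iota => /andP[/andP[/c_ge0]].
  rewrite ler_pdivlMr// mulr_sumr.
  apply: (@le_trans _ _ (\sum_(1 <= k < N.+1) c k * G k)).
    apply: ler_sum_nat => k /andP[k1 kN].
    rewrite mulrC ler_wpM2l ?c_ge0//.
    (* Restrict the minimum to the one-point range [k], where it is at most [G k]. *)
    apply: le_trans (@le_bigmin_nat _ _ _ 1 N.+1 k k.+1 xpredT G k1 kN) _.
    by rewrite big_ltn// ge_min lexx.
  apply: le_trans (telescope N) _.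
  by rewrite lerD2l lerN2; apply: ge_inf => //; exists (xag N).
move=> cf xs [Xxs xs_min] al mono N N1.
set D := fun k => enorm (x k - xs) ^+ 2.
have Gamma0 k : 0 < uag_Gamma alpha k.
  elim: k => [|[|k] IH]; rewrite ?ltr01//=.
  by rewrite mulr_gt0// subr_gt0; have /andP[] := a_itv k.+2 isT.
have step k : Psi (xag k.+1) - Psi xs
    <= (1 - alpha k.+1) * (Psi (xag k) - Psi xs)
       + alpha k.+1 / (2 * lambda k.+1) * (D k - D k.+1).
  apply: le_trans (accelerated_step cX gf cchi L0 lip cf (aP k.+1 isT)
    (l0 k.+1 isT) (al k.+1 isT) (Xxag k) (Xx k) Xxs (xmdE k.+1 isT)
    (xtE k.+1 isT) (x_min k.+1 isT)).
  by rewrite lerD2r xag_min// ge_min lexx orbT.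
(* The estimate [step] divided by [Gamma k] and summed, kept multiplied out. *)
have inv k : Psi (xag k.+1) - Psi xs <=
    uag_Gamma alpha k.+1 * D 0%N / (2 * lambda 1%N)
    - alpha k.+1 / (2 * lambda k.+1) * D k.+1.
  (* In the base case [alpha 1 = 1] removes the initial gap [Psi (xag 0) - Psi xs]. *)
  elim: k => [|k IH].
    by have := step 0%N; rewrite a1 /= subrr mul0r add0r; lra.
  apply: le_trans (step k.+1) _.
  have a01 : 0 <= 1 - alpha k.+2.
    by rewrite subr_ge0; have /andP[_ /ltW] := a_itv k.+2 isT.
  have Dk0 : 0 <= D k.+1 by rewrite sqr_ge0.
  (* This is [mono] multiplied by [Gamma / 2] at index [k.+2]; it makes the coefficient of [D k.+1]
     nonpositive after [IH] is inserted in [step]. *)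
  have ak : alpha k.+2 / (2 * lambda k.+2)
      <= (1 - alpha k.+2) * (alpha k.+1 / (2 * lambda k.+1)).
    have g1 := Gamma0 k.+1; have l1 := l0 k.+1 isT; have l2 := l0 k.+2 isT.
    have a2 : 0 < 1 - alpha k.+2.
      by rewrite subr_gt0; have /andP[] := a_itv k.+2 isT.
    have := mono k.+1 isT.
    rewrite -[uag_Gamma alpha k.+2]/((1 - alpha k.+2) * uag_Gamma alpha k.+1).
    move: (uag_Gamma alpha k.+1) g1 => g g1.
    rewrite -(ler_pM2r (_ : 0 < (1 - alpha k.+2) * g / 2)); last first.
      by rewrite divr_gt0// mulr_gt0.
    congr (_ <= _); field; rewrite ?gt_eqF//=.
  have h1 := ler_wpM2l a01 IH.
  have h2 := ler_wpM2r Dk0 ak.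
  rewrite -[uag_Gamma alpha k.+2]/((1 - alpha k.+2) * uag_Gamma alpha k.+1).
  move: h1 h2; lra.
case: N N1 => [//|N _].
apply: le_trans (inv N) _.
rewrite gerBl mulr_ge0 ?sqr_ge0// divr_ge0//.
  by have /andP[/ltW] := aP N.+1 isT.
by rewrite mulr_ge0// ltW// l0.
Qed.
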